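(* Let $L=[l_{ij}]\in\mathbb{R}^{n\times n}$ be the graph Laplacian of a weighted directed graph, and suppose that $L$ has the $m\times m$ block lower triangular form $$L=\begin{bmatrix}L_{11}&0&\cdots&0\\ L_{21}&L_{22}&\cdots&0\\ \vdots&\vdots&\ddots&\vdots\\ L_{m1}&L_{m2}&\cdots&L_{mm}\end{bmatrix},$$ where each $L_{ii}\in\mathbb{R}^{p_i\times p_i}$ is irreducible and $[L_{i1},\dots,L_{i(i-1)}]\neq0$ for $i=2,\dots,m$. Let $[\xi_1,\dots,\xi_n]^\top$ be the left eigenvector of $L$ for the eigenvalue $0$ with $\sum_{i=1}^n\xi_i=1$ (so $\xi_i>0$ for $i\le p_1$ and $\xi_i=0$ for $i>p_1$). Let $s\in\mathbb{R}$, let $0<\eta_1\le\eta_2<1/\xi_1$, and let $(b_k)$ be a sequence with $\eta_1\le b_k\le\eta_2$ for each $k$. Let $x(0)\in\mathbb{R}^n$ satisfy $\bar x(0)=\sum_{i=1}^{p_1}\xi_ix_i(0)\ne s$. Then there is a constant $T>0$ such that for every sequence $0=t_0<t_1<t_2<\cdots$ with $t_{k+1}-t_k\ge T$ for each $k\ge0$, the solution $x(t)$, with initial value $x(0)$, of the impulsively pinned system with strengths $b_k$, impulse times $t_k$ and target value $s$ reaches consensus on $s$, i.e. $\lim_{t\to\infty}x_i(t)=s$ for all $i=1,\dots,n$.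
   Context: Graph Laplacian: for a weighted directed graph with nonnegative weights $a_{ij}$ ($i\neq j$), $l_{ij}=-a_{ij}$ for $i\ne j$ and $l_{ii}=\sum_{k\ne i}a_{ik}$; thus off-diagonal entries are $\le0$ and row sums are $0$. A $1\times1$ matrix is regarded as irreducible. The displayed block form is the form taken, after reordering nodes, by the Laplacian of a graph having a spanning directed tree; the nodes $1,\dots,p_1$ are the roots. Impulsively pinned system (pinning node $1$, target $s$): $x(t)=[x_1(t),\dots,x_n(t)]^\top$ satisfies $$\dot x_i(t)=-\sum_{j=1}^n l_{ij}x_j(t),\quad i=1,\dots,n,\ t\ne t_k,$$ $$x_1(t_k^+)=x_1(t_k^-)+b_k\,[s-x_1(t_k^-)],\qquad x_i(t_k^+)=x_i(t_k^-)\ \ (i=2,\dots,n),$$ where $b_k$ is the impulsive strength at time $t_k$ and $x(t_k^\pm)$ are one-sided limits. Convention: $x(t_k)=x(t_k^+)$; the initial value is $x(0)=x(t_0^+)$, so the impulses acting on the solution are those at $t_k$, $k\ge1$. *)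

(* Defs.v *)
From HB Require Import structures.
From mathcomp Require Import all_boot all_order all_algebra all_fingroup.
From mathcomp Require Import all_classical all_reals all_analysis.

Set Implicit Arguments.
Unset Strict Implicit.
Unset Printing Implicit Defensive.

Import Order.TTheory GRing.Theory Num.Theory.
Import numFieldNormedType.Exports.

Local Open Scope classical_set_scope.
Local Open Scope ring_scope.

(* [a i j] is the weight entering row [i]; the diagonal of [a] is ignored. *)
Definition laplacian (R : realType) (n : nat) (a : 'M[R]_n) : 'M[R]_n :=
  \matrix_(i, j) (if i == j then \sum_(k | k != i) a i k else - a i j).

(* [A] is reducible when some simultaneous permutation of its rows and columns
   is block lower triangular with square diagonal blocks of sizes [r] and
   [n - r], both nonzero.  A 1 x 1 matrix, even zero, is thus irreducible. *)
Definition reducible (R : realType) (n : nat) (A : 'M[R]_n) : Prop :=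
  exists (sigma : 'S_n) (r : nat), (0 < r < n)%N /\
    forall i j : 'I_n, (i < r)%N -> (r <= j)%N ->
      row_perm sigma (col_perm sigma A) i j = 0.

Definition irreducible (R : realType) (n : nat) (A : 'M[R]_n) : Prop :=
  ~ reducible A.

(* Only the values of [x] on the half-line from [t 0 = 0] on matter.  The
   solution is right-continuous at every [t k]; no impulse acts at [t 0], so
   [b 0] is not used.  In the last clause [xl] is the left limit of [x] at
   [t k]. *)
Definition pinned_solution (R : realType) (n : nat) (L : 'M[R]_n)
    (pin : 'I_n) (s : R) (b t : nat -> R) (x0 : 'cV[R]_n)
    (x : R -> 'cV[R]_n) : Prop :=
  [/\ x (t 0%N) = x0,
      forall (k : nat) (i : 'I_n),
        x u i 0 @[u --> (t k)^'+] --> x (t k) i 0,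
      forall u : R, t 0%N < u -> (forall k : nat, u != t k) ->
        forall i : 'I_n,
          is_derive u (1 : R) (fun v : R => x v i 0)
            (- \sum_(j < n) L i j * x u j 0)
    & forall k : nat, (1 <= k)%N ->
        exists xl : 'cV[R]_n,
          [/\ forall i : 'I_n, x u i 0 @[u --> (t k)^'-] --> xl i 0,
              x (t k) pin 0 = xl pin 0 + b k * (s - xl pin 0)
            & forall i : 'I_n, i != pin -> x (t k) i 0 = xl i 0]].

(* Main.v *)
(* Put y = x - s.  Between impulses y' = - L y, which conserves c = xi y and
   keeps all coordinates between their initial extrema; since node 1 reaches
   every node, the spread max y - min y shrinks by any prescribed factor eps
   after a long enough time.  An impulse replaces c by c - b xi_1 y_1 with
   y_1 close to c, and changes the spread by at most b |y_1|.  With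
   theta = eta1 xi_1, for eps small the quantity
   |c| + (theta / (2 eta2)) * spread is therefore multiplied by at most
   1 - theta / 2 from one impulse to the next. *)
Require Import Defs.
From HB Require Import structures.
From mathcomp Require Import all_boot all_order all_algebra all_fingroup.
From mathcomp Require Import all_classical all_reals all_analysis.
From mathcomp Require Import ring lra zify.

Set Implicit Arguments.
Unset Strict Implicit.
Unset Printing Implicit Defensive.

Import Order.TTheory GRing.Theory Num.Theory.
Import numFieldNormedType.Exports.

Local Open Scope classical_set_scope.
Local Open Scope ring_scope.

(** * Reachability of every node from the first node *)

(** Listing the nodes of [N] first and those of its complement afterwards gives the permutation,
    with [r = #|N|]. *)
Lemma reducible_of_set (R : realType) (n : nat) (A : 'M[R]_n) (N : {set 'I_n})
    (i0 j0 : 'I_n) :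
  i0 \in N -> j0 \notin N ->
  (forall i j, i \in N -> j \notin N -> A i j = 0) -> reducible A.
Proof.
move=> i0N j0N A0.
pose e := enum N ++ enum (~: N).
have size_e : size e = n.
  by rewrite size_cat -!cardE cardsC card_ord.
have uniq_e : uniq e.
  rewrite cat_uniq !enum_uniq andbT /=; apply/hasPn => x.
  by rewrite !mem_enum inE.
pose f (i : 'I_n) := nth i0 e i.
have f_inj : injective f.
  move=> i j /eqP; rewrite nth_uniq ?size_e // => /eqP; exact: val_inj.
exists (perm f_inj), #|N|; split.
  have : (0 < #|N|)%N by apply/card_gt0P; exists i0.
  have : (0 < #|~: N|)%N by apply/card_gt0P; exists j0; rewrite inE.
  by have := cardsC N; rewrite card_ord; lia.
move=> i j ltiN leNj; rewrite !mxE !permE; apply: A0.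
  by rewrite /f nth_cat -cardE ltiN -mem_enum mem_nth // -cardE.
rewrite /f nth_cat -cardE ltnNge leNj /=.
have : nth i0 (enum (~: N)) (j - #|N|) \in enum (~: N).
  rewrite mem_nth // -cardE.
  by rewrite ltn_subLR // cardsC card_ord.
by rewrite mem_enum inE.
Qed.

(** An edge from [j] to [k] means that [j] drives [k]. The set [S] of nodes reached from [r]
    swallows every diagonal block that it meets, by irreducibility, and a nonzero block left of the
    diagonal makes it meet each later block; induction on the block index concludes. *)
Lemma block_root (R : realType) (m : nat) (p : 'I_m.+1 -> nat)
    (L : 'M[R]_(\sum_(i < m.+1) p i)) (r : 'I_(\sum_(i < m.+1) p i)) :
  (forall i, irreducible (submxblock L i i)) ->
  (forall i : 'I_m.+1, (0 < i)%N ->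
     exists j : 'I_m.+1, (j < i)%N /\ submxblock L i j != 0) ->
  r = 0%N :> nat -> (0 < p ord0)%N ->
  forall i, connect [rel j k | (j != k) && (L k j != 0)] r i.
Proof.
move=> irr link r0 p0 i; set e := (X in connect X).
pose S := [pred i | connect e r i].
have S_step j k : j \in S -> L k j != 0 -> k \in S.
  move=> Sj Lkj; have [<-//|jk] := eqVneq j k.
  by apply: (connect_trans Sj); apply: connect1; rewrite /e /= jk.
have S_block k v : tagnat.Rank k v \in S -> forall u, tagnat.Rank k u \in S.
  (* Within block [k], a row outside [S] vanishes on the columns in [S], so a proper nonempty part
     outside [S] would reduce the block. *)
  move=> Sv u; apply: contrapT => /negP nSu; apply: (irr k).
  apply: (@reducible_of_set _ _ _ [set w | tagnat.Rank k w \notin S] u v).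
  - by rewrite inE.
  - by rewrite inE negbK.
  - move=> w w'; rewrite !inE negbK => nSw Sw'; rewrite mxE.
    by apply/eqP; apply: contraNT nSw; apply: S_step Sw'.
suff all_S : forall d (k : 'I_m.+1), (k < d)%N ->
    forall u, tagnat.Rank k u \in S.
  have := all_S m.+1 (tagnat.sig1 i) (ltn_ord _) (tagnat.sig2 i).
  by rewrite tagnat.sig2K.
elim=> // d IH k; rewrite ltnS => kd.
have [k0|k_gt0] := posnP k.
  have -> : k = ord0 by exact: val_inj.
  apply: (S_block _ (Ordinal p0)).
  suff -> : tagnat.Rank ord0 (Ordinal p0) = r by exact: connect0.
  by apply: ord_inj; rewrite tagnat.RankEsum r0 /= big_pred0.
have [j [jk Lkj]] := link _ k_gt0.
have /existsP [u /existsP [v Luv]] :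
    [exists u, exists v, submxblock L k j u v != 0].
  apply: contraNT Lkj => /existsPn L0; apply/eqP/matrixP => u v.
  by have /existsPn/(_ v) := L0 u; rewrite negbK => /eqP ->; rewrite mxE.
apply: (S_block k u); apply: (@S_step (tagnat.Rank j v)).
  by apply: IH; exact: leq_trans kd.
by move: Luv; rewrite mxE.
Qed.

(** * Flow of the Laplacian: comparison, growth and conservation *)

(** Only left difference quotients enter, so the minimum may sit at the right end of the interval on
    which it is taken. *)
Lemma is_derive_min_left (R : realType) (f : R -> R) (a c df : R) :
  a < c -> is_derive c 1 f df -> (forall v, a <= v <= c -> f c <= f v) ->
  df <= 0.
Proof.
move=> ac fc cmin; have [fcc <-] := fc.
rewrite /derive cvg_at_leftE //; apply: limr_le.
  by apply/cvg_ex; exists ('D_1 f c); apply: cvg_dnbhs_at_left.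
near=> h.
have h0 : h < 0 by near: h; exact: nbhs_left_lt.
have hac : a - c < h by near: h; apply: nbhs_left_gt; rewrite subr_lt0.
rewrite /= /GRing.scale /= mulr1; apply: mulr_le0_ge0.
  by rewrite invr_le0 ltW.
rewrite subr_ge0; apply: cmin; lra.
Unshelve. all: by end_near. Qed.

(** One stretch between impulses: right continuity at [alpha], where the state has just jumped, and
    no condition at [beta], where the next impulse acts. *)
Definition flow (R : realType) (n : nat) (L : 'M[R]_n) (alpha beta : R)
    (z : R -> 'I_n -> R) : Prop :=
  (forall i, z u i @[u --> alpha^'+] --> z alpha i) /\
  forall u, alpha < u < beta -> forall i,
    is_derive u (1 : R) (fun v => z v i) (- \sum_(j < n) L i j * z u j).

Section Flow.
Variables (R : realType) (n : nat) (L : 'M[R]_n).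
Hypothesis L_row : forall i, \sum_(j < n) L i j = 0.
Hypothesis L_off : forall i j, i != j -> L i j <= 0.
Implicit Types (z : R -> 'I_n -> R) (alpha beta : R).

Lemma flow_continuous alpha beta z u i : flow L alpha beta z ->
  alpha < u < beta -> {for u, continuous (fun v => z v i)}.
Proof.
move=> [_ zd] uab; have [? _] := zd u uab i.
by apply: differentiable_continuous; apply/derivable1_diffP.
Qed.

Lemma flow_within alpha beta z u i : flow L alpha beta z ->
  alpha < u < beta -> {within `[alpha, u], continuous (fun v => z v i)}.
Proof.
move=> zf /[dup] uab /andP[au ub]; apply/continuous_within_itvP => //; split.
- move=> v; rewrite in_itv /= => /andP[av vu].
  by apply: (flow_continuous zf); rewrite av (lt_trans vu).
- by case: zf.
- exact/cvg_at_left_filter/(flow_continuous zf).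
Qed.

Lemma flow_sub alpha beta z alpha' : flow L alpha beta z ->
  alpha <= alpha' < beta -> flow L alpha' beta z.
Proof.
move=> /[dup] zf [za zd] /andP[+ a'b]; rewrite le_eqVlt => /predU1P[<- //|aa'].
split=> [i|u /andP[au ub]]; last by apply: zd; rewrite (lt_trans aa').
by apply/cvg_at_right_filter/(flow_continuous zf); rewrite aa'.
Qed.

(** Zero row sums make [L] annihilate constants. The case [c = -1] exchanges minima and maxima. *)
Lemma flow_affine alpha beta z c d : flow L alpha beta z ->
  flow L alpha beta (fun u i => c * z u i + d).
Proof.
move=> [za zd]; split=> [i|u uab i].
  by apply: cvgD; [apply: cvgM => //; exact: cvg_cst|exact: cvg_cst].
have := zd u uab i => zdi.
have -> : - (\sum_(j < n) L i j * (c * z u j + d)) =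
    c *: - (\sum_(j < n) L i j * z u j) + 0.
  rewrite /GRing.scale /= addr0 mulrN mulr_sumr; congr -%R.
  under eq_bigr do rewrite mulrDr mulrCA.
  by rewrite big_split /= -mulr_suml L_row mul0r addr0.
by apply: is_deriveD; exact: is_deriveZ.
Qed.

(* At a point where [z v i + e * (v - alpha)] is minimal over both [i] and [v],
   the Laplacian term pushes [z i] up, so the derivative is at least [e > 0];
   hence [v] must be the left end point. *)
Lemma flow_min alpha beta z c : flow L alpha beta z ->
  (forall i, c <= z alpha i) ->
  forall u i, alpha <= u < beta -> c <= z u i.
Proof.
move=> zf zc u i /andP[+ ub]; rewrite le_eqVlt => /predU1P[<- //|au].
apply/ler_addgt0Pl => e e0.
have ua0 : 0 < u - alpha by rewrite subr_gt0.
(* With this slope the perturbation equals [e] at time [u]. *)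
pose e' := e / (u - alpha).
have e'0 : 0 < e' by rewrite divr_gt0.
pose g j v := z v j + e' * (v - alpha).
have gmin j : exists w, w \in `[alpha, u] /\
    forall v, v \in `[alpha, u] -> g j w <= g j v.
  suff /(EVT_min (ltW au)) [w wau wmin] :
      {within `[alpha, u], continuous (g j)}.
    by exists w.
  move=> v; apply: cvgD.
    by apply: (@flow_within _ _ _ _ j zf) v; rewrite au.
  by apply: cvgM; [exact: cvg_cst|apply: cvgB; [|exact: cvg_cst]];
     apply: continuous_subspaceT => // ?.
have [w wP] := choice gmin.
case: (arg_minP (fun j => g j (w j)) (isT : xpredT i)) => j _ jmin.
have [+ wmin] := wP j; rewrite in_itv /= => /andP[+ wu].
have : c <= g j (w j) -> c <= e + z u i.
  move=> /le_trans; apply; apply: (le_trans (jmin i isT)).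
  apply: (le_trans ((wP i).2 u _)); first by rewrite in_itv /= (ltW au) lexx.
  by rewrite /g /e' mulfVK ?gt_eqF // addrC.
move=> /[swap]; rewrite le_eqVlt => /predU1P[<-|aw]; apply.
  by rewrite /g subrr mulr0 addr0.
have wab : alpha < w j < beta by rewrite aw (le_lt_trans wu).
have [_ /(_ _ wab j) zd] := zf.
have gd : is_derive (w j) 1 (g j)
    (- (\sum_(k < n) L j k * z (w j) k) + e' *: (1 - 0)).
  by apply: is_deriveD; apply: is_deriveZ; exact: is_deriveB.
have := is_derive_min_left aw gd.
have /[swap] /[apply] : forall v, alpha <= v <= w j -> g j (w j) <= g j v.
  by move=> v /andP[av vw]; apply: wmin; rewrite in_itv /= av (le_trans vw).
rewrite /GRing.scale /= subr0 mulr1 => le0.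
suff : \sum_(k < n) L j k * z (w j) k <= 0 by lra.
(* After subtracting a zero row sum, each difference is nonnegative: [g k (w j)] is at least
   [g k (w k)], hence at least [g j (w j)], and the perturbations at [w j] cancel. *)
have -> : \sum_(k < n) L j k * z (w j) k =
    \sum_(k < n) L j k * (z (w j) k - z (w j) j).
  under [RHS]eq_bigr do rewrite mulrBr.
  by rewrite sumrB -mulr_suml L_row mul0r subr0.
apply: sumr_le0 => k _; have [->|jk] := eqVneq j k.
  by rewrite subrr mulr0.
apply: mulr_le0_ge0; first exact: L_off.
have := jmin k isT; have := (wP k).2 (w j).
rewrite in_itv /= (ltW aw) wu /g => /(_ isT); lra.
Qed.

Lemma flow_max alpha beta z c : flow L alpha beta z ->
  (forall i, z alpha i <= c) ->
  forall u i, alpha <= u < beta -> z u i <= c.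
Proof.
move=> /(flow_affine (-1) 0) zf zc u i uab.
have := @flow_min _ _ _ (- c) zf _ u i uab; rewrite mulN1r addr0 lerN2; apply.
by move=> j; rewrite mulN1r addr0 lerN2.
Qed.

(* The derivative of [exp (D (v - alpha)) * z v i] is
   [exp (D (v - alpha)) * (D * z v i - \sum_j L i j * z v j)]. *)
Lemma flow_growth alpha beta z (D C : R) k u i : flow L alpha beta z ->
  alpha <= u < beta ->
  (forall v, alpha < v < u -> C * (k%:R * (v - alpha) ^+ k.-1) <=
     expR (D * (v - alpha)) * (D * z v i - \sum_(j < n) L i j * z v j)) ->
  z alpha i + C * ((u - alpha) ^+ k - 0 ^+ k) <= expR (D * (u - alpha)) * z u i.
Proof.
move=> zf /andP[+ ub]; rewrite le_eqVlt => /predU1P[<- _|au dle].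
  by rewrite !subrr !mulr0 expR0 mul1r addr0.
pose lin (c : R) := (fun v => c * (v - alpha)) : R -> R.
have lind (c v : R) : is_derive v 1 (lin c) c.
  have : is_derive v 1 (lin c) (c *: (1 - 0)).
    by apply: is_deriveZ; exact: is_deriveB.
  by rewrite /GRing.scale /= subr0 mulr1.
(* The hypothesis says that [f] has nonnegative derivative. Its value at [alpha] contains
   [C * 0 ^+ k]; since [0 ^+ 0 = 1], the case [k = 0] compares the exponential terms alone. *)
pose f v := expR (D * (v - alpha)) * z v i - C * (v - alpha) ^+ k.
pose df v := (expR (D * (v - alpha)) * - (\sum_(j < n) L i j * z v j) +
   z v i * (expR (D * (v - alpha)) * D)) - C * (k%:R * (v - alpha) ^+ k.-1).
have expd (v : R) : is_derive v 1 (fun v => expR (D * (v - alpha)))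
    (expR (D * (v - alpha)) * D).
  exact: (is_derive1_comp (is_derive_expR _) (lind D v)).
have powd (v : R) : is_derive v 1 (fun v => C * (v - alpha) ^+ k)
    (C * (k%:R * (v - alpha) ^+ k.-1)).
  apply: is_deriveZ.
  have : is_derive v 1 (fun v : R => v - alpha) (1 - 0) by exact: is_deriveB.
  move=> /(is_deriveX k).
  by rewrite /GRing.scale /= subr0 mulr1 exprfctE.
have fd (v : R) : v \in `]alpha, u[ -> is_derive v 1 f (df v).
  rewrite in_itv /= => /andP[av vu].
  have [_ /(_ v _ i) zd] := zf; apply: is_deriveB; apply: is_deriveM.
  by apply: zd; rewrite av (lt_trans vu).
have fc : {within `[alpha, u], continuous f}.
  have dc (h : R -> R) (dh : R -> R) : (forall v : R, is_derive v 1 h (dh v)) ->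
      {within `[alpha, u], continuous h}.
    move=> hd; apply: derivable_within_continuous => v _.
    by have [] := hd v.
  move=> v; apply: cvgB; last exact: (dc _ _ powd) v.
  apply: cvgM; first exact: (dc _ _ expd) v.
  by apply: (@flow_within _ _ _ _ i zf) v; rewrite au.
have [w] := MVT au fd fc; rewrite in_itv /= => wau fE.
have : 0 <= f u - f alpha.
  rewrite fE mulr_ge0 ?subr_ge0 ?(ltW au)//.
  have := dle w wau; rewrite /df; lra.
by rewrite /f !subrr mulr0 expR0 mul1r; lra.
Qed.

(** The derivative of the weighted sum is minus the product of [xi *m L] with [z], which is zero. *)
Lemma flow_conserved alpha beta z (xi : 'rV[R]_n) : xi *m L = 0 ->
  flow L alpha beta z -> forall u, alpha <= u < beta ->
  \sum_i xi 0 i * z u i = \sum_i xi 0 i * z alpha i.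
Proof.
move=> xiL zf u /andP[+ ub]; rewrite le_eqVlt => /predU1P[<- //|au].
pose f : R -> R := \sum_(i < n) (fun v => xi 0 i * z v i).
have fE v : f v = \sum_i xi 0 i * z v i by rewrite /f fct_sumE.
have fd (v : R) : v \in `]alpha, u[ -> is_derive v 1 f 0.
  rewrite in_itv /= => /andP[av vu].
  have -> : 0 = \sum_i xi 0 i *: - (\sum_(j < n) L i j * z v j).
    under eq_bigr do rewrite /GRing.scale /= mulrN mulr_sumr.
    rewrite sumrN exchange_big /= big1 ?oppr0 // => j _.
    under eq_bigr do rewrite mulrA.
    have /matrixP/(_ 0 j) := xiL.
    by rewrite !mxE -mulr_suml => ->; rewrite mul0r.
  apply: is_derive_sum => i; apply: is_deriveZ.
  by apply: zf.2; rewrite av (lt_trans vu).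
have fc : {within `[alpha, u], continuous f}.
  have -> : f = (fun v => \sum_i xi 0 i * z v i) by apply/funext.
  move=> v; apply: (cvg_big add_continuous) => i _.
  apply: cvgM; first exact: cvg_cst.
  by apply: (@flow_within _ _ _ _ i zf) v; rewrite au.
have [w _] := MVT au fd fc; rewrite mul0r !fE => /eqP.
by rewrite subr_eq0 => /eqP.
Qed.
End Flow.

(** * Contraction of the spread along the flow *)

Section Contraction.
Variables (R : realType) (n : nat) (L : 'M[R]_n).
Hypothesis L_row : forall i, \sum_(j < n) L i j = 0.
Hypothesis L_off : forall i j, i != j -> L i j <= 0.
Implicit Types (z : R -> 'I_n -> R) (alpha beta : R).

(** Once [D] dominates the diagonal entry, row [i] of [D - L] has nonnegative entries. This feeds
    the derivative bound of [flow_growth]. *)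
Lemma outflow_ge0 (D : R) (w : 'I_n -> R) i : L i i <= D ->
  (forall k, 0 <= w k) -> 0 <= D * w i - \sum_(k < n) L i k * w k.
Proof.
move=> LD w0; rewrite (bigD1 i) //= opprD addrA -mulrBl -sumrN.
apply: addr_ge0; first by rewrite mulr_ge0 // subr_ge0.
by apply: sumr_ge0 => k ki; rewrite -mulNr mulr_ge0 // oppr_ge0 L_off // eq_sym.
Qed.

Lemma inflow_le (D : R) (w : 'I_n -> R) i j : L i i <= D -> j != i ->
  (forall k, 0 <= w k) -> - L i j * w j <= D * w i - \sum_(k < n) L i k * w k.
Proof.
move=> LD ji w0; rewrite (bigD1 i) //= (bigD1 j) //= !opprD !addrA -mulrBl.
rewrite mulNr addrAC -[leLHS]add0r lerD2r -sumrN.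
apply: addr_ge0; first by rewrite mulr_ge0 // subr_ge0.
apply: sumr_ge0 => k /andP[ki _].
by rewrite -mulNr mulr_ge0 // oppr_ge0 L_off // eq_sym.
Qed.

Let influence := [rel j k | (j != k) && (L k j != 0)].

(* Along a path of length [k] from [r] to [i], positivity is transmitted with
   a factor of order [(u - alpha) ^+ k]. *)
Lemma flow_reach (D : R) r i : (forall j, L j j <= D) ->
  connect influence r i ->
  exists k (g : R), 0 < g /\ forall alpha beta z, flow L alpha beta z ->
    (forall j, 0 <= z alpha j) -> forall u, alpha <= u < beta ->
    g * (u - alpha) ^+ k * z alpha r <= expR (D * (u - alpha)) * z u i.
Proof.
move=> LD /connectP[p + ->] {i}; elim/last_ind: p => [_|p i IH].
  exists 0%N, 1; split=> // alpha beta z zf z0 u uab.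
  rewrite expr0 !mul1r /=.
  have := @flow_growth _ _ _ _ _ _ D 0 0 u r zf uab.
  rewrite mul0r addr0; apply => v /andP[av vu].
  rewrite mul0r mulr_ge0 ?expR_ge0 // outflow_ge0 // => k.
  apply: (flow_min L_row L_off zf z0).
  by rewrite (ltW av) (lt_trans vu) //; case/andP: uab.
rewrite rcons_path last_rcons => /andP[/IH [k [g [g0 gP]]]].
set j := last r p => /andP[ji Lij].
have l0 : 0 < - L i j by rewrite oppr_gt0 lt_neqAle Lij L_off // eq_sym.
(* The last edge contributes its weight [- L i j]; integrating [(v - alpha) ^+ k] contributes the
   division by [k.+1]. *)
exists k.+1, (- L i j * g / k.+1%:R); split.
  by rewrite divr_gt0 ?mulr_gt0.
move=> alpha beta z zf z0 u uab.
have := @flow_growth _ _ _ _ _ _ D (- L i j * g / k.+1%:R * z alpha r)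
  k.+1 u i zf uab.
rewrite expr0n /= subr0 [X in _ + X]mulrAC => growth.
apply: le_trans (growth _); first by rewrite lerDr.
move=> v /andP[av vu] /=.
have vab : alpha <= v < beta.
  by rewrite (ltW av) (lt_trans vu) //; case/andP: uab.
have zv0 m : 0 <= z v m by exact: (flow_min L_row L_off zf z0).
apply: (@le_trans _ _ (expR (D * (v - alpha)) * (- L i j * z v j))).
  have -> : - L i j * g / k.+1%:R * z alpha r * (k.+1%:R * (v - alpha) ^+ k) =
      - L i j * (g * (v - alpha) ^+ k * z alpha r).
    by field; rewrite nat1r pnatr_eq0.
  by rewrite [leRHS]mulrCA ler_pM2l //; exact: (gP _ _ _ zf).
by rewrite ler_pM2l ?expR_gt0 // inflow_le.
Qed.

Variable r : 'I_n.
Hypothesis r_root : forall i, connect influence r i.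

Lemma flow_positive : exists g : R, 0 < g <= 1 /\
  forall alpha beta z, flow L alpha beta z -> (forall j, 0 <= z alpha j) ->
  alpha + 1 < beta -> forall i, g * z alpha r <= z (alpha + 1) i.
Proof.
pose D := \sum_i `|L i i|.
have LD j : L j j <= D.
  rewrite (le_trans (ler_norm _)) // /D (bigD1 j) //= lerDl.
  exact: sumr_ge0.
have reach i : exists gi : R, 0 < gi /\
    forall alpha beta z, flow L alpha beta z -> (forall j, 0 <= z alpha j) ->
    alpha + 1 < beta -> gi * z alpha r <= z (alpha + 1) i.
  have [k [g [g0 gP]]] := flow_reach LD (r_root i).
  exists (g * expR (- D)); split; first by rewrite mulr_gt0 ?expR_gt0.
  move=> alpha beta z zf z0 ab.
  have := gP _ _ _ zf z0 (alpha + 1).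
  rewrite ab lerDl ler01 => /(_ isT).
  rewrite addrAC subrr add0r expr1n !mulr1 expRN => gz.
  by rewrite mulrAC ler_pdivrMr ?expR_gt0 // [leRHS]mulrC.
have [g gP] := choice reach.
(* Finitely many positive constants have a positive minimum; the default value 1 also gives
   [g <= 1]. *)
exists (\big[Order.min/1]_i g i); split.
  rewrite lt_bigmin ?bigmin_le_id // => i _; exact: (gP i).1.
move=> alpha beta z zf z0 ab i.
apply: le_trans ((gP i).2 _ _ _ zf z0 ab).
by apply: ler_wpM2r; [exact: z0|exact: bigmin_le].
Qed.

(** Positivity applied to [z - min] and to [max - z] moves both extremes inward, by
    [g * (z r - min)] and [g * (max - z r)]. These gains add up to [g] times the initial spread
    wherever [z r] lies. *)
Lemma flow_contract : exists rho : R, 0 <= rho < 1 /\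
  forall alpha beta z d, flow L alpha beta z ->
  (forall i j, z alpha i - z alpha j <= d) -> alpha + 1 < beta ->
  forall i j, z (alpha + 1) i - z (alpha + 1) j <= rho * d.
Proof.
have [g [/andP[g0 g1] gP]] := flow_positive.
exists (1 - g / 2); split; first by apply/andP; split; lra.
move=> alpha beta z d zf zd ab i j.
have [k _ kmin] := arg_minP (z alpha) (isT : xpredT r).
have [l _ lmax] := arg_maxP (z alpha) (isT : xpredT r).
have {}kmin m : z alpha k <= z alpha m by exact: kmin.
have {}lmax m : z alpha m <= z alpha l by exact: lmax.
have aab : alpha <= alpha + 1 < beta by rewrite ab lerDl ler01.
have zk := flow_min L_row L_off zf kmin j aab.
have zl := flow_max L_row L_off zf lmax i aab.
have := zd l k.
have h1 := gP _ _ _ (flow_affine L_row 1 (- z alpha k) zf).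
have h2 := gP _ _ _ (flow_affine L_row (- 1) (z alpha l) zf).
have {}h1 : g * (z alpha r - z alpha k) <= z (alpha + 1) j - z alpha k.
  have := h1 _ ab j; rewrite !mul1r; apply => m.
  by rewrite mul1r subr_ge0.
have {}h2 : g * (z alpha l - z alpha r) <= z alpha l - z (alpha + 1) i.
  have := h2 _ ab i; rewrite !mulN1r ![- _ + _]addrC; apply => m.
  by rewrite mulN1r addrC subr_ge0.
move: zk zl.
move: g0 g1 h1 h2; nra.
Qed.

Lemma flow_spread alpha beta z d : flow L alpha beta z ->
  (forall i j, z alpha i - z alpha j <= d) ->
  forall u, alpha <= u < beta -> forall i j, z u i - z u j <= d.
Proof.
move=> zf zd u uab i j.
have [k _ kmin] := arg_minP (z alpha) (isT : xpredT r).
have [l _ lmax] := arg_maxP (z alpha) (isT : xpredT r).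
have := flow_min L_row L_off zf (fun m => kmin m isT) j uab.
have := flow_max L_row L_off zf (fun m => lmax m isT) i uab.
have := zd l k; lra.
Qed.

Lemma flow_decay (eps : R) : 0 < eps -> exists T : R, 0 < T /\
  forall alpha beta z d, flow L alpha beta z ->
  (forall i j, z alpha i - z alpha j <= d) ->
  forall u, alpha + T <= u < beta -> forall i j, z u i - z u j <= eps * d.
Proof.
move=> eps0; have [rho [/andP[rho0 rho1] rhoP]] := flow_contract.
have [N rhoN] : exists N, rho ^+ N <= eps.
  have rho1' : `|rho| < 1 by rewrite ger0_norm.
  have /cvgrPdist_le/(_ _ eps0)[N _ /(_ N (leqnn N))] := cvg_expr rho1'.
  by rewrite /= sub0r normrN ger0_norm ?exprn_ge0 //; exists N.
(* [N] unit steps give the factor; [N.+1] keeps [T] positive even when [N = 0]. *)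
exists N.+1%:R; split=> // alpha beta z d zf zd u /andP[au ub] i j.
have d0 : 0 <= d by rewrite (le_trans _ (zd r r)) // subrr.
have pow k : (k <= N)%N -> forall i j,
    z (alpha + k%:R) i - z (alpha + k%:R) j <= rho ^+ k * d.
  elim: k => [_|k IH kN]; first by rewrite addr0 expr0 mul1r.
  rewrite -natr1 addrA exprS -mulrA; apply: (rhoP _ beta) => //.
  - apply: (flow_sub zf); rewrite lerDl ler0n /=; apply: le_lt_trans ub.
    by apply: le_trans au; rewrite lerD2l ler_nat ltnW // ltnW.
  - exact: IH (ltnW kN).
  - apply: le_lt_trans ub; apply: le_trans au.
    by rewrite -addrA natr1 lerD2l ler_nat ltnW.
have aNu : alpha + N%:R <= u.
  by apply: le_trans au; rewrite lerD2l ler_nat.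
apply: le_trans (ler_wpM2r d0 rhoN).
apply: (flow_spread (flow_sub zf _) (pow N (leqnn N))); last by rewrite aNu.
by rewrite lerDl ler0n (le_lt_trans aNu).
Qed.
End Contraction.

(** * Effect of one impulse on the weighted mean and the spread *)

(** As the weights sum to 1, the deviation is the sum of [xi j * (w i - w j)]; the weights may have
    either sign, whence the absolute values. *)
Lemma mean_dist (R : realType) (n : nat) (xi w : 'I_n -> R) (d : R) :
  \sum_i xi i = 1 -> (forall i j, w i - w j <= d) ->
  forall i, `|w i - \sum_j xi j * w j| <= (\sum_j `|xi j|) * d.
Proof.
move=> xi1 wd i; rewrite -[w i]mul1r -xi1 mulr_suml -sumrB mulr_suml.
apply: le_trans (ler_norm_sum _ _ _) _; apply: ler_sum => j _.
rewrite -mulrBr normrM ler_wpM2l // ler_norml.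
by have := wd i j; have := wd j i => ? ?; apply/andP; split; lra.
Qed.

(** The new mean is [(1 - c * xi pin) * m - c * xi pin * (w pin - m)] with [c * xi pin] between 0
    and 1. The spread grows by at most the jump [c * w pin], where [w pin] is within [K * d] of the
    mean. *)
Lemma impulse_step (R : realType) (n : nat) (xi y w : 'I_n -> R) (pin : 'I_n)
    (eta1 eta2 c V d : R) (K := \sum_j `|xi j|) :
  \sum_i xi i = 1 -> 0 < eta1 -> eta1 <= c <= eta2 -> 0 < xi pin ->
  eta2 * xi pin < 1 ->
  `|\sum_i xi i * w i| <= V -> (forall i j, w i - w j <= d) ->
  y pin = w pin - c * w pin -> (forall i, i != pin -> y i = w i) ->
  `|\sum_i xi i * y i| <= (1 - eta1 * xi pin) * V + K * d /\
  forall i j, y i - y j <= d + eta2 * (V + K * d).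
Proof.
move=> xi1 eta10 /andP[c1 c2] xi0 eta2xi wV wd ypin yi.
have := mean_dist xi1 wd pin; rewrite -/K.
have -> : \sum_i xi i * y i = \sum_i xi i * w i - c * xi pin * w pin.
  rewrite (bigD1 pin) //= [in RHS](bigD1 pin) //= ypin.
  rewrite (eq_bigr (fun i => xi i * w i)); first by ring.
  by move=> i /yi ->.
move: wV; set m := \sum_i xi i * w i => wV wm.
have V0 : 0 <= V by exact: le_trans wV.
have Kd0 : 0 <= K * d by exact: le_trans wm.
have cx0 : 0 <= c * xi pin by nra.
have cx1 : c * xi pin <= 1 by nra.
split.
  have -> : m - c * xi pin * w pin =
      (1 - c * xi pin) * m - c * xi pin * (w pin - m) by ring.
  apply: le_trans (ler_normB _ _) _.
  rewrite (normrM (1 - _)) (normrM (c * xi pin)) (ger0_norm cx0)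
    (ger0_norm (_ : 0 <= 1 - c * xi pin)); last lra.
  apply: lerD.
    apply: (@le_trans _ _ ((1 - c * xi pin) * V)).
      by rewrite ler_wpM2l //; lra.
    by rewrite ler_wpM2r // lerD2l lerN2 ler_wpM2r // ltW.
  by apply: le_trans wm; rewrite ler_piMl.
have d0 : 0 <= d by rewrite (le_trans _ (wd pin pin)) // subrr.
have wpin : `|c * w pin| <= eta2 * (V + K * d).
  rewrite normrM (ger0_norm (_ : 0 <= c)); last lra.
  apply: ler_pM => //; first lra.
  rewrite -[w pin](subrK m) addrC; apply: le_trans (ler_normD _ _) _; lra.
move=> i j; have := wd i j.
move: wpin; rewrite ler_norml => /andP[].
have [->|/yi ->] := eqVneq i pin; have [->|/yi ->] := eqVneq j pin;
  rewrite ?ypin; lra.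
Qed.

(** * Consensus of the pinned system *)

Lemma pinned_flow (R : realType) (n : nat) (L : 'M[R]_n) (pin : 'I_n) (s : R)
    (b t : nat -> R) (x0 : 'cV[R]_n) (x : R -> 'cV[R]_n) k :
  (forall i, \sum_(j < n) L i j = 0) -> (forall k, t k < t k.+1) ->
  pinned_solution L pin s b t x0 x ->
  flow L (t k) (t k.+1) (fun u i => x u i 0 - s).
Proof.
move=> L_row tS [_ xr xd _].
have t_le : {homo t : i j / (i <= j)%N >-> i <= j}.
  by apply: homo_leq => [//|? ? ?|i]; [exact: le_trans|exact: ltW].
have : flow L (t k) (t k.+1) (fun u i => x u i 0).
  split=> // u /andP[ku uk] i; apply: xd.
    by apply: le_lt_trans ku; exact: t_le.
  move=> j; case: (leqP j k) => [/t_le jk|/t_le kj].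
    by rewrite gt_eqF // (le_lt_trans jk).
  by rewrite lt_eqF // (lt_le_trans uk).
move=> /(flow_affine L_row 1 (- s)).
by congr flow; apply/funext => u; apply/funext => i; rewrite mul1r.
Qed.

Lemma impulse_at (R : realType) (n : nat) (L : 'M[R]_n) (pin : 'I_n) (s : R)
    (b t : nat -> R) (x0 : 'cV[R]_n) (x : R -> 'cV[R]_n) k :
  pinned_solution L pin s b t x0 x ->
  exists w : 'I_n -> R, [/\ forall i, x u i 0 - s @[u --> (t k.+1)^'-] --> w i,
    x (t k.+1) pin 0 - s = w pin - b k.+1 * w pin
    & forall i, i != pin -> x (t k.+1) i 0 - s = w i].
Proof.
move=> [_ _ _ /(_ k.+1 isT)[xl [xlP xpin xi]]].
exists (fun i => xl i 0 - s); split.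
- by move=> i; apply: cvgB => //; exact: cvg_cst.
- by rewrite xpin; ring.
- by move=> i /xi ->.
Qed.

Lemma pinned_consensus (R : realType) (n : nat) (L : 'M[R]_n) (r pin : 'I_n)
    (xi : 'rV[R]_n) (s eta1 eta2 : R) (b : nat -> R) :
  (forall i, \sum_(j < n) L i j = 0) -> (forall i j, i != j -> L i j <= 0) ->
  (forall i, connect [rel j k | (j != k) && (L k j != 0)] r i) ->
  xi *m L = 0 -> \sum_i xi 0 i = 1 ->
  0 < eta1 -> eta2 < 1 / xi 0 pin -> (forall k, eta1 <= b k <= eta2) ->
  exists T : R, 0 < T /\ forall (t : nat -> R) (x0 : 'cV[R]_n),
    t 0%N = 0 -> (forall k, t k < t k.+1) -> (forall k, T <= t k.+1 - t k) ->
    forall x : R -> 'cV[R]_n, pinned_solution L pin s b t x0 x ->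
    forall i, x u i 0 @[u --> +oo] --> s.
Proof.
move=> L_row L_off root xiL xi1 eta1_gt0 eta2_lt bP.
have eta12 : eta1 <= eta2 by have /andP[] := bP 0%N; exact: le_trans.
have eta2_gt0 : 0 < eta2 by exact: lt_le_trans eta12.
(* The bound [0 < eta2 < 1 / xi 0 pin] forces positivity, the inverse of 0 being 0. *)
have xi_gt0 : 0 < xi 0 pin.
  by rewrite -invr_gt0 -div1r; exact: lt_trans eta2_lt.
have eta2xi : eta2 * xi 0 pin < 1 by rewrite -ltr_pdivlMr.
pose K := \sum_j `|xi 0 j|.
have K0 : 0 <= K by exact: sumr_ge0.
pose theta := eta1 * xi 0 pin.
have theta_gt0 : 0 < theta by exact: mulr_gt0.
have theta_lt1 : theta < 1.
  by apply: le_lt_trans eta2xi; rewrite ler_wpM2r // ltW.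
(* Half of the gain [theta] pays for the spread that the impulse creates. *)
pose delta := theta / (2 * eta2).
have delta_gt0 : 0 < delta by rewrite divr_gt0 // mulr_gt0.
have deltaE : delta * eta2 = theta / 2 by rewrite /delta; field; rewrite gt_eqF.
(* [M] is the coefficient of [eps * d] in the updated [V + delta * d]. *)
pose M := K + delta + delta * eta2 * K.
have M_gt0 : 0 < M.
  have : 0 <= delta * eta2 * K by rewrite mulr_ge0 // mulr_ge0 // ltW.
  by rewrite /M; lra.
pose eps := delta / (2 * M).
have eps_gt0 : 0 < eps by rewrite divr_gt0 // mulr_gt0.
have epsE : eps * M = delta / 2 by rewrite /eps; field; rewrite gt_eqF.
have [T [T_gt0 decay]] := flow_decay L_row L_off root eps_gt0.
(* The extra unit leaves room for the left limit at [t k.+1] and gives [k%:R <= t k], so the impulse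
   times are unbounded. *)
exists (T + 1); split; first by rewrite addr_gt0.
move=> t x0 t0 tS tT x xsol i.
pose q := 1 - theta / 2.
have q0 : 0 <= q by rewrite /q; lra.
have q1 : q < 1 by rewrite /q; lra.
pose y u j := x u j 0 - s.
pose c u := \sum_j xi 0 j * y u j.
have yflow k : flow L (t k) (t k.+1) y by exact: pinned_flow xsol.
have c_flow k u : t k <= u < t k.+1 -> c u = c (t k).
  exact: (flow_conserved xiL (yflow k)).
(* [V] and [d] are upper bounds carried through the induction in place of the exact mean and
   spread. *)
have [U bound] : exists U : R, forall k, exists V d : R,
    [/\ `|c (t k)| <= V, forall j l, y (t k) j - y (t k) l <= d
      & V + delta * d <= q ^+ k * U].
  pose d0 := 2 * \sum_j `|y (t 0%N) j|.
  exists (`|c (t 0%N)| + delta * d0); elim=> [|k [V [d [cV yd Vd]]]].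
    exists `|c (t 0%N)|, d0; split=> [//|j l|]; last by rewrite expr0 mul1r.
    have le_sum m : `|y (t 0%N) m| <= \sum_j `|y (t 0%N) j|.
      by rewrite [leRHS](bigD1 m) //= lerDl sumr_ge0.
    have := le_sum j; have := le_sum l.
    rewrite /d0 !ler_norml => /andP[? ?] /andP[? ?]; lra.
  have [w [yw ypin yi]] := impulse_at k xsol.
  have Tlt : t k + T < t k.+1 by have := tT k; lra.
  (* The decay holds on [[t k + T, t k.+1[] and passes to the left limit. *)
  have wd j l : w j - w l <= eps * d.
    have yjl : y u j - y u l @[u --> (t k.+1)^'-] --> w j - w l.
      exact: (cvgB (yw j) (yw l)).
    rewrite -(cvg_lim _ yjl) //; apply: limr_le.
      by apply/cvg_ex; exists (w j - w l).
    near=> u.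
    apply: (decay _ _ _ _ (yflow k) yd); apply/andP; split.
      by near: u; exact: nbhs_left_ge.
    by near: u; exact: nbhs_left_lt.
  have wV : `|\sum_j xi 0 j * w j| <= V.
    have cw : c u @[u --> (t k.+1)^'-] --> \sum_j xi 0 j * w j.
      apply: (cvg_big add_continuous) => j _.
      by apply: cvgM; [exact: cvg_cst|exact: yw].
    have -> : \sum_j xi 0 j * w j = c (t k); last by [].
    apply: (norm_cvg_unique cw); apply: cvg_near_cst; near=> u.
    apply: c_flow; apply/andP; split.
      by near: u; exact: nbhs_left_ge.
    by near: u; exact: nbhs_left_lt.
  have [cV' yd'] :=
    impulse_step xi1 eta1_gt0 (bP k.+1) xi_gt0 eta2xi wV wd ypin yi.
  exists ((1 - theta) * V + K * (eps * d)).
  exists (eps * d + eta2 * (V + K * (eps * d))).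
  split=> //.
  have -> : (1 - theta) * V + K * (eps * d) +
      delta * (eps * d + eta2 * (V + K * (eps * d))) =
      (1 - theta + delta * eta2) * V + eps * M * d by rewrite /M; ring.
  rewrite deltaE epsE exprS -[leRHS]mulrA.
  apply: le_trans (ler_wpM2l q0 Vd).
  have d_ge0 : 0 <= d by rewrite (le_trans _ (yd r r)) // subrr.
  have dd_ge0 : 0 <= delta * d by rewrite mulr_ge0 // ltW.
  (* As [theta < 1], [q] exceeds 1/2, so it absorbs the factor 1/2 in [eps * M = delta / 2]. *)
  have qd : 0 <= (q - 1 / 2) * (delta * d).
    by apply: mulr_ge0 => //; rewrite /q; lra.
  move: qd; rewrite /q; lra.
have t_le : {homo t : k l / (k <= l)%N >-> k <= l}.
  by apply: homo_leq => [//|? ? ?|k]; [exact: le_trans|exact: ltW].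
have t_ge k : k%:R <= t k.
  elim: k => [|k IH]; first by rewrite t0.
  by rewrite -natr1; have := tT k; lra.
(* Since [V] and [delta * d] are each at most [q ^+ k * U], the bound [V + K * d] on a coordinate is
   at most [q ^+ k * A]. *)
pose A := U * (1 + K / delta).
have y_le k u : t k <= u -> `|y u i| <= q ^+ k * A.
  move=> ku.
  have [j [kj ju uj]] : exists j, [/\ (k <= j)%N, t j <= u & u < t j.+1].
    have ex_gt : exists j, u < t j.
      exists (Num.bound `|u|); apply: lt_le_trans (t_ge _).
      by apply: le_lt_trans (ler_norm u) _; rewrite archi_boundP.
    (* The predecessor of the first index with [u < t j] labels the interval containing [u]. *)
    case: (ex_minnP ex_gt) => j uj jmin.
    have kj : (k < j)%N.
      rewrite ltnNge; apply/negP => /t_le jk.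
      by have := lt_le_trans uj (le_trans jk ku); rewrite ltxx.
    exists j.-1; rewrite prednK ?(leq_trans _ kj) //; split=> //.
      by rewrite -ltnS prednK // (leq_trans _ kj).
    rewrite leNgt; apply/negP => /jmin.
    rewrite -[X in (X <= _)%N]prednK ?ltnn //.
    by rewrite (leq_trans _ kj).
  have uB : t j <= u < t j.+1 by rewrite ju.
  have [V [d [cV yd Vd]]] := bound j.
  have V_ge0 : 0 <= V by exact: le_trans cV.
  have d_ge0 : 0 <= d by rewrite (le_trans _ (yd r r)) // subrr.
  have dd_ge0 : 0 <= delta * d by rewrite mulr_ge0 // ltW.
  have yud := flow_spread L_row L_off r (yflow j) yd uB.
  have := mean_dist xi1 yud i; rewrite -/(c u) (c_flow j) // -/K => yc.
  apply: (@le_trans _ _ (V + K * d)).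
    rewrite -[y u i](subrK (c (t j))) addrC.
    by apply: le_trans (ler_normD _ _) _; lra.
  apply: (@le_trans _ _ (q ^+ j * U * (1 + K / delta))).
    rewrite mulrDr mulr1; apply: lerD; first lra.
    rewrite mulrCA ler_wpM2l // ler_pdivlMr // mulrC; lra.
  have U_ge0 : 0 <= U.
    have [V0 [e0 [cV0 ye0]]] := bound 0%N; rewrite expr0 mul1r; apply: le_trans.
    by rewrite addr_ge0 ?(le_trans _ cV0) // mulr_ge0 ?(ltW delta_gt0) //
      (le_trans _ (ye0 r r)) // subrr.
  rewrite -mulrA; apply: ler_wpM2r.
    by rewrite mulr_ge0 // addr_ge0 // divr_ge0 // ltW.
  by apply: ler_wiXn2l => //; exact: ltW.
apply/cvgrPdist_le => e e_gt0.
have [k qk] : exists k, q ^+ k * A <= e.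
  have q1' : `|q| < 1 by rewrite ger0_norm.
  have : q ^+ k * A @[k --> \oo] --> 0 * A.
    by apply: cvgM; [exact: cvg_expr|exact: cvg_cst].
  move=> /cvgrPdist_le/(_ _ e_gt0)[N _ /(_ N (leqnn N))].
  rewrite /= mul0r sub0r normrN => NA.
  by exists N; exact: le_trans (ler_norm _) NA.
near=> u; rewrite distrC; apply: le_trans qk; apply: y_le.
by near: u; exact/nbhs_pinfty_ge/num_real.
Unshelve. all: by end_near. Qed.

(** * Application to block triangular Laplacians *)

Lemma laplacian_row (R : realType) (n : nat) (a : 'M[R]_n) i :
  \sum_(j < n) laplacian a i j = 0.
Proof.
rewrite (bigD1 i) //= mxE eqxx; under eq_bigr => j ji.
  rewrite mxE eq_sym (negPf ji); over.
by rewrite sumrN subrr.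
Qed.

Lemma laplacian_off (R : realType) (n : nat) (a : 'M[R]_n) :
  (forall i j, i != j -> 0 <= a i j) ->
  forall i j, i != j -> laplacian a i j <= 0.
Proof. by move=> a0 i j ij; rewrite mxE (negPf ij) oppr_le0 a0. Qed.

Theorem theorem2 (R : realType) (m : nat) (p : 'I_m.+1 -> nat)
    (hp : forall i : 'I_m.+1, (0 < p i)%N)
    (a L : 'M[R]_(\sum_(i < m.+1) p i))
    (ha : forall i j : 'I_(\sum_(k < m.+1) p k), i != j -> 0 <= a i j)
    (hL : L = laplacian a)
    (htriang : forall i j : 'I_m.+1, (i < j)%N -> submxblock L i j = 0)
    (hirred : forall i : 'I_m.+1, irreducible (submxblock L i i))
    (hlink : forall i : 'I_m.+1, (0 < i)%N ->
       exists j : 'I_m.+1, (j < i)%N /\ submxblock L i j != 0)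
    (xi : 'rV[R]_(\sum_(i < m.+1) p i))
    (hxi : xi *m L = 0)
    (hxi1 : \sum_i xi 0 i = 1)
    (node1 : 'I_(\sum_(i < m.+1) p i)) (hnode1 : node1 = 0%N :> nat)
    (s eta1 eta2 : R)
    (heta1 : 0 < eta1) (heta12 : eta1 <= eta2) (heta2 : eta2 < 1 / xi 0 node1)
    (b : nat -> R) (hb : forall k : nat, eta1 <= b k <= eta2)
    (x0 : 'cV[R]_(\sum_(i < m.+1) p i))
    (hx0 : \sum_(i < \sum_(j < m.+1) p j | (i < p ord0)%N) xi 0 i * x0 i 0 != s) :
  exists T : R, 0 < T /\
    forall t : nat -> R,
      t 0%N = 0 ->
      (forall k : nat, t k < t k.+1) ->
      (forall k : nat, T <= t k.+1 - t k) ->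
      forall x : R -> 'cV[R]_(\sum_(i < m.+1) p i),
        pinned_solution L node1 s b t x0 x ->
        forall i : 'I_(\sum_(k < m.+1) p k), x u i 0 @[u --> +oo] --> s.
Proof.
have L_row i : \sum_j L i j = 0 by rewrite hL laplacian_row.
have L_off i j : i != j -> L i j <= 0 by rewrite hL; exact: laplacian_off.
(* The block structure enters as reachability from [node1], at once root and pinned node. *)
have root := block_root hirred hlink hnode1 (hp ord0).
have [T [T_gt0 cons]] :=
  pinned_consensus s L_row L_off root hxi hxi1 heta1 heta2 hb.
by exists T; split=> // t t0 tS tT x; exact: cons.
Qed.
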